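(* Let $G=(A,B,E)$ be a bipartite graph with $n$ vertices and maximum matching $M^*$, whose edges arrive as a stream $\pi$ in an arbitrary order. Consider the following two-pass algorithm: (1) let $p=\sqrt2-1$ and take an independent random sample $A'\subseteq A$ with $\Pr[a\in A']=p$ for each $a\in A$; let $F_1$ be the set of edges with one endpoint in $A'$; (2) first pass: compute $M_0\gets\mathrm{Greedy}(\pi)$ and $M'\gets\mathrm{Greedy}(F_1\cap\pi)$ in parallel; (3) $M_1\gets\{e\in M' : e \text{ goes between } B(M_0) \text{ and } A\setminus A(M_0)\}$; (4) $F_2\gets\{da : d\in B\setminus B(M_0),\ a\in A(M_0),\ \exists b,c \text{ with } ab\in M_0,\ bc\in M_1\}$; (5) second pass: $M_2\gets\mathrm{Greedy}(F_2\cap\pi)$; (6) return the matching $M$ obtained from $M_0$ by augmenting with $M_1$ and $M_2$ (for every $da\in M_2$, with $ab\in M_0$ and $bc\in M_1$, remove $ab$ and add $da$ and $bc$). Then this is a randomized two-pass semi-streaming algorithm for maximum bipartite matching such that, for every bipartite graph and every arrival order, the expected size of the returned matching over the algorithm's internal random coins is at least $(\frac12+0.019)|M^*|$; it can be implemented with $O(1)$ processing time per edge.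
   Context: A $k$-pass semi-streaming algorithm receives the edges of an $n$-vertex graph as a stream, performs at most $k$ passes over the stream, uses memory $O(n\,\mathrm{polylog}\, n)$, and has running time $O(t)$ per edge ($t$ the processing time per letter). $\mathrm{Greedy}(\sigma)$ for a sequence $\sigma$ of edges: start with $M=\emptyset$ and, processing edges in order, add edge $e$ to $M$ whenever $M\cup\{e\}$ is still a matching; output $M$. For a set $F$ of vertex pairs and a stream $\sigma$, $F\cap\sigma$ is the subsequence of $\sigma$ of edges in $F$. For a vertex set $S$ and edge set $F$, $S(F)$ denotes the vertices of $S$ covered by $F$. The sets $A,B$ are known in advance. *)

(* Defs.v *)
From mathcomp Require Import all_boot all_order all_algebra.

Set Implicit Arguments.
Unset Strict Implicit.
Unset Printing Implicit Defensive.

(** * Bipartite graphs, matchings, Greedy *)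

Section Matching.

(* The vertex classes are the two types A and B; an edge is a pair in A * B. *)
Variables A B : finType.
Implicit Types (M F E : {set A * B}) (s : seq (A * B)).

Definition is_matching M : bool :=
  [forall e in M, forall f in M, (e != f) ==> (e.1 != f.1) && (e.2 != f.2)].

Definition maximum_matching E M : Prop :=
  [/\ is_matching M, M \subset E &
      forall N, is_matching N -> N \subset E -> #|N| <= #|M|].

Definition arrival_order s E : Prop := perm_eq s (enum E).

Definition greedy s : {set A * B} :=
  foldl (fun M e => if is_matching (e |: M) then e |: M else M) set0 s.

Definition substream F s : seq (A * B) := [seq e <- s | e \in F].

Definition coverA F : {set A} := [set e.1 | e in F].
Definition coverB F : {set B} := [set e.2 | e in F].

(** * The two-pass algorithm on the stream [s] with random sample [A'] *)

Variables (s : seq (A * B)) (A' : {set A}).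

Definition tpF1 : {set A * B} := [set e | e.1 \in A'].

Definition tpM0 : {set A * B} := greedy s.

Definition tpM' : {set A * B} := greedy (substream tpF1 s).

Definition tpM1 : {set A * B} :=
  [set e in tpM' | (e.2 \in coverB tpM0) && (e.1 \notin coverA tpM0)].

Definition tpF2 : {set A * B} :=
  [set e : A * B | [&& e.2 \notin coverB tpM0, e.1 \in coverA tpM0 &
     [exists b : B, exists c : A, ((e.1, b) \in tpM0) && ((c, b) \in tpM1)]]].

Definition tpM2 : {set A * B} := greedy (substream tpF2 s).

(* (d, a, b, c) is one of the paths along which M0 is augmented. *)
Definition aug_path (d : B) (a : A) (b : B) (c : A) : bool :=
  [&& (a, d) \in tpM2, (a, b) \in tpM0 & (c, b) \in tpM1].

Definition two_pass : {set A * B} :=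
  (tpM0 :\: [set e : A * B | [exists d : B, exists c : A, aug_path d e.1 e.2 c]])
  :|: [set e : A * B | [exists b : B, exists c : A, aug_path e.2 e.1 b c]]
  :|: [set e : A * B | [exists d : B, exists a : A, aug_path d a e.2 e.1]].

End Matching.

(** * Independent sampling *)

Section Expectation.
Import GRing.Theory.
Local Open Scope ring_scope.

(* Expectation of X S when each x : T is put in S independently with
   probability p. *)
Definition expect_sample (R : pzRingType) (T : finType) (p : R)
    (X : {set T} -> R) : R :=
  \sum_(S : {set T}) (\prod_(x : T) (if x \in S then p else 1 - p)) * X S.

End Expectation.

(** * A word RAM reading a stream of edges *)

Inductive binop := Add | Sub | Mul | Lt | Eq.

Definition eval_binop (o : binop) (m n : nat) : nat :=
  match o with
  | Add => m + n
  | Sub => m - n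
  | Mul => m * n
  | Lt => m < n
  | Eq => m == n
  end.

(* Operands x, y, z are fixed cell addresses. There are no registers besides
   the memory cells. *)
Inductive cmd :=
  | Skip
  | Seq of cmd & cmd
  | Const of nat & nat          (* [x] := k *)
  | Op of binop & nat & nat & nat (* [x] := [y] o [z] *)
  | Read of nat & nat           (* [x] := [[y]] *)
  | Write of nat & nat          (* [[x]] := [y] *)
  | Flip of nat                 (* [x] := next random bit *)
  | Emit of nat & nat           (* output the edge ([x], [y]) *)
  | If of nat & cmd & cmd
  | While of nat & cmd.

Record state := State {
  st_mem : nat -> nat;
  st_coins : seq bool;          (* read-once *)
  st_out : seq (nat * nat)      (* write-only *)
}.

Definition upd (m : nat -> nat) (x v : nat) : nat -> nat :=
  fun y => if y == x then v else m y.

Definition set_cell (s : state) (x v : nat) : state :=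
  State (upd (st_mem s) x v) (st_coins s) (st_out s).

Section Machine.

(* wd: word length in bits; sp: number of memory cells. An execution gets stuck
   when it addresses a cell outside the sp available ones, computes a value that
   does not fit in a word, or flips a coin when none is left. *)
Variables wd sp : nat.

Local Notation fits v := (v < 2 ^ wd).

(* exec c s t s': from s, the command c terminates in s' after t unit-cost
   steps. *)
Inductive exec : cmd -> state -> nat -> state -> Prop :=
  | ExecSkip s : exec Skip s 1 s
  | ExecSeq c1 c2 s s1 s2 t1 t2 :
      exec c1 s t1 s1 -> exec c2 s1 t2 s2 -> exec (Seq c1 c2) s (t1 + t2) s2
  | ExecConst x k s :
      x < sp -> fits k -> exec (Const x k) s 1 (set_cell s x k)
  | ExecOp o x y z s :
      x < sp -> y < sp -> z < sp ->
      fits (eval_binop o (st_mem s y) (st_mem s z)) ->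
      exec (Op o x y z) s 1
        (set_cell s x (eval_binop o (st_mem s y) (st_mem s z)))
  | ExecRead x y s :
      x < sp -> y < sp -> st_mem s y < sp ->
      exec (Read x y) s 1 (set_cell s x (st_mem s (st_mem s y)))
  | ExecWrite x y s :
      x < sp -> y < sp -> st_mem s x < sp ->
      exec (Write x y) s 1 (set_cell s (st_mem s x) (st_mem s y))
  | ExecFlip x m (b : bool) r o :
      x < sp -> fits (b : nat) ->
      exec (Flip x) (State m (b :: r) o) 1 (State (upd m x b) r o)
  | ExecEmit x y m r o :
      x < sp -> y < sp ->
      exec (Emit x y) (State m r o) 1 (State m r ((m x, m y) :: o))
  | ExecIfT x c1 c2 s s' t :
      x < sp -> st_mem s x != 0 -> exec c1 s t s' ->
      exec (If x c1 c2) s t.+1 s'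
  | ExecIfF x c1 c2 s s' t :
      x < sp -> st_mem s x = 0 -> exec c2 s t s' ->
      exec (If x c1 c2) s t.+1 s'
  | ExecWhileT x c s s1 s2 t1 t2 :
      x < sp -> st_mem s x != 0 -> exec c s t1 s1 ->
      exec (While x c) s1 t2 s2 -> exec (While x c) s (t1 + t2).+1 s2
  | ExecWhileF x c s :
      x < sp -> st_mem s x = 0 -> exec (While x c) s 1 s.

(* Two input words are delivered in cells 0 and 1. *)
Definition feed (u v : nat) (s : state) : state :=
  set_cell (set_cell s 0 u) 1 v.

Definition can_feed (u v : nat) : bool := [&& 1 < sp, fits u & fits v].

(* T bounds the number of steps spent on each edge. *)
Variable T : nat.

Inductive run_letters (c : cmd) : seq (nat * nat) -> state -> state -> Prop :=
  | LettersNil s : run_letters c [::] s s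
  | LettersCons u v l s t s1 s2 :
      can_feed u v -> exec c (feed u v s) t s1 -> t <= T ->
      run_letters c l s1 s2 -> run_letters c ((u, v) :: l) s s2.

(* A pass consists of a program run before the pass and a program run on each
   edge of the stream. Only the latter is bounded by the processing time per
   letter; both are subject to the space bound. *)
Inductive run_passes (l : seq (nat * nat)) :
    seq (cmd * cmd) -> state -> state -> Prop :=
  | PassesNil s : run_passes l [::] s s
  | PassesCons c0 c ps s t s1 s2 s3 :
      exec c0 s t s1 -> run_letters c l s1 s2 -> run_passes l ps s2 s3 ->
      run_passes l ((c0, c) :: ps) s s3.

End Machine.

Record stream_prog := StreamProg {
  sp_passes : seq (cmd * cmd);
  sp_finish : cmd
}.

Definition edge_code nA nB (e : 'I_nA * 'I_nB) : nat * nat :=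
  (nat_of_ord e.1, nat_of_ord e.2).

(* Initially the memory is zero except for nA and nB in cells 0 and 1, the coin
   tape holds one bit per vertex of A, and the output is empty. *)
Definition init_state nA nB (A' : {set 'I_nA}) : state :=
  feed nA nB (State (fun=> 0) [seq a \in A' | a <- enum 'I_nA] [::]).

Definition stream_run (wd sp T : nat) (P : stream_prog) nA nB
    (s : seq ('I_nA * 'I_nB)) (A' : {set 'I_nA}) (o : seq (nat * nat)) : Prop :=
  exists s1 s2 t,
    [/\ can_feed wd sp nA nB,
        run_passes wd sp T [seq edge_code e | e <- s] (sp_passes P)
          (init_state nB A') s1,
        exec wd sp (sp_finish P) s1 t s2 &
        st_out s2 = o].

Definition bigO (f g : nat -> nat) : Prop :=
  exists C N, forall n, N <= n -> f n <= C * g n.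

(* P is a k-pass semi-streaming algorithm with processing time tm per letter
   whose output, on every stream of distinct edges and every outcome of the
   coins, is the edge set prescribed by Out. The space is counted in bits. *)
Definition semi_streaming (k : nat) (tm : nat -> nat) (P : stream_prog)
    (Out : forall nA nB, seq ('I_nA * 'I_nB) -> {set 'I_nA} ->
           {set 'I_nA * 'I_nB}) : Prop :=
  size (sp_passes P) <= k /\
  exists wd sp T : nat -> nat,
    [/\ bigO wd (trunc_log 2),
        exists d, bigO (fun n => sp n * wd n) (fun n => n * trunc_log 2 n ^ d),
        bigO T tm &
        forall nA nB (s : seq ('I_nA * 'I_nB)) (A' : {set 'I_nA}), uniq s ->
          exists2 o,
            stream_run (wd (nA + nB)) (sp (nA + nB)) (T (nA + nB)) P s A' o &
            perm_eq o [seq edge_code e | e <- enum (Out nA nB s A')]].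

(* Main.v *)
Require Import Defs.
From mathcomp Require Import all_boot all_order all_algebra.
From mathcomp Require Import zify ring lra.

(* Write m0, m1, m2 for the sizes of M0, M1, M2 and m for that of a maximum
   matching. Every M2-edge augments M0, so the output has size m0 + m2.

   If b is free in the sampled greedy run without a, then sampling a makes a
   matched; since the B-vertices matched by greedy grow with the sample, this
   gives Pr(a matched) >= p (1 - Pr(b matched)) for each optimal edge ab, hence
   (1 + p) E|M'| >= p m. At most p m0 edges of M' are expected to start in
   A(M0), and by maximality of M0 all the others are in M1, so
   E m1 >= E|M'| - p m0. At least m - m0 optimal edges avoid B(M0), and all of
   these start in A(M0); hence at least m1 - (2 m0 - m) of them lie in F2, and
   greedy finds half of these. A linear combination of these inequalities with
   E|M| >= m0 gives the ratio (1 + p/(1+p)) / (2 + p) > 0.535.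

   On the machine, each vertex has a record with its mates in M0, M', M2 and its
   sample bit; membership in F2 is then decided by following three mates. *)

Set Implicit Arguments.
Unset Strict Implicit.
Unset Printing Implicit Defensive.

Import Order.TTheory GRing.Theory Num.Theory.

(** * Greedy matchings *)

Section Greedy.

Variables A B : finType.
Implicit Types (M N F : {set A * B}) (s : seq (A * B)) (e f : A * B).

Lemma is_matchingP M :
  reflect (forall e f, e \in M -> f \in M -> e.1 = f.1 \/ e.2 = f.2 -> e = f)
          (is_matching M).
Proof.
apply: (iffP forall_inP) => [H e f eM fM | H e eM].
  have /forall_inP /(_ f fM) /implyP H' := H e eM.
  have [//|ne] := eqVneq e f; have /andP[/eqP n1 /eqP n2] := H' ne.
  by case.
apply/forall_inP => f fM; apply/implyP => ne.
by apply/andP; split; apply: contra_neq ne => E; apply: H => //; [left|right].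
Qed.

Lemma matching_inj1 M : is_matching M -> {in M &, injective (fun e => e.1)}.
Proof. by move=> /is_matchingP H e f eM fM E; apply: H => //; left. Qed.

Lemma matching_inj2 M : is_matching M -> {in M &, injective (fun e => e.2)}.
Proof. by move=> /is_matchingP H e f eM fM E; apply: H => //; right. Qed.

Lemma matching_fun1 M a b b' :
  is_matching M -> (a, b) \in M -> (a, b') \in M -> b = b'.
Proof. by move=> mM h h'; case: (matching_inj1 mM h h' erefl). Qed.

Lemma matching_fun2 M a a' b :
  is_matching M -> (a, b) \in M -> (a', b) \in M -> a = a'.
Proof. by move=> mM h h'; case: (matching_inj2 mM h h' erefl). Qed.

Lemma matchingS M N : M \subset N -> is_matching N -> is_matching M.
Proof.
move=> /subsetP sMN /is_matchingP mN; apply/is_matchingP => e f eM fM.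
by apply: mN; apply: sMN.
Qed.

Lemma mem_coverA M a b : (a, b) \in M -> a \in coverA M.
Proof. by move=> h; apply/imsetP; exists (a, b). Qed.

Lemma mem_coverB M a b : (a, b) \in M -> b \in coverB M.
Proof. by move=> h; apply/imsetP; exists (a, b). Qed.

Lemma coverAP M a : reflect (exists b, (a, b) \in M) (a \in coverA M).
Proof.
apply: (iffP imsetP) => [[[x y] h ->]|[b h]]; first by exists y.
by exists (a, b).
Qed.

Lemma coverBP M b : reflect (exists a, (a, b) \in M) (b \in coverB M).
Proof.
apply: (iffP imsetP) => [[[x y] h ->]|[a h]]; first by exists x.
by exists (a, b).
Qed.

Lemma coverAU1 M e : coverA (e |: M) = e.1 |: coverA M.
Proof. by rewrite /coverA imsetU1. Qed.

Lemma coverBU1 M e : coverB (e |: M) = e.2 |: coverB M.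
Proof. by rewrite /coverB imsetU1. Qed.

Lemma card_coverA M : is_matching M -> #|coverA M| = #|M|.
Proof. by move=> mM; apply/card_in_imset/matching_inj1. Qed.

Lemma card_coverB M : is_matching M -> #|coverB M| = #|M|.
Proof. by move=> mM; apply/card_in_imset/matching_inj2. Qed.

Lemma matchingU1 M e : is_matching M -> e \notin M ->
  is_matching (e |: M) = (e.1 \notin coverA M) && (e.2 \notin coverB M).
Proof.
case: e => x y mM nM; apply/is_matchingP/andP => [H|[/= n1 n2] e f].
  split; apply/imsetP => -[[z w] h /= E]; move: (nM).
    by rewrite (H (x, y) (z, w)) ?h // ?setU11 ?(setU1r _ h) //; left.
  by rewrite (H (x, y) (z, w)) ?h // ?setU11 ?(setU1r _ h) //; right.
rewrite !inE => /predU1P[->|eM] /predU1P[->|fM] //=.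
- by case: f fM => z w fM /= [] E; move: n1 n2;
    rewrite E ?(mem_coverA fM) ?(mem_coverB fM).
- by case: e eM => z w eM /= [] E; move: n1 n2;
    rewrite -E ?(mem_coverA eM) ?(mem_coverB eM).
- by move/is_matchingP: mM; apply.
Qed.

Lemma greedy_rcons_step s e :
  greedy (rcons s e) =
  if is_matching (e |: greedy s) then e |: greedy s else greedy s.
Proof. by rewrite /greedy foldl_rcons. Qed.

Lemma greedy_matching s : is_matching (greedy s).
Proof.
elim/last_ind: s => [|s e IH].
  by apply/is_matchingP => e f; rewrite inE.
by rewrite greedy_rcons_step; case: ifP.
Qed.

Lemma greedy_rcons s e :
  greedy (rcons s e) =
  if (e.1 \in coverA (greedy s)) || (e.2 \in coverB (greedy s)) then greedy s
  else e |: greedy s.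
Proof.
rewrite greedy_rcons_step.
have [eM|nM] := boolP (e \in greedy s).
  have /setUidPr -> : [set e] \subset greedy s by rewrite sub1set.
  by case: ifP; case: ifP.
by rewrite matchingU1 ?greedy_matching // -negb_or; case: ifP; case: ifP.
Qed.

Lemma greedy_sub s e : e \in greedy s -> e \in s.
Proof.
elim/last_ind: s => [|s f IH]; first by rewrite inE.
rewrite greedy_rcons mem_rcons inE; case: ifP => _; first by move/IH->; rewrite orbT.
by rewrite !inE => /predU1P[->|/IH ->]; rewrite ?eqxx ?orbT.
Qed.

Lemma greedy_maximal s e : e \in s ->
  (e.1 \in coverA (greedy s)) || (e.2 \in coverB (greedy s)).
Proof.
elim/last_ind: s => [//|s f IH].
rewrite greedy_rcons mem_rcons inE => /predU1P[->|/IH h].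
  by case: ifP => //; rewrite coverAU1 setU11.
case: ifP => // _; rewrite coverAU1 coverBU1 !inE.
by case/orP: h => ->; rewrite !orbT.
Qed.

(** By maximality every edge of [N] has a covered end; a covered vertex lies on at most one edge of
    [N], and [greedy s] covers as many vertices on each side as it has edges. *)
Lemma card_le_greedy2 s N :
  is_matching N -> {subset N <= s} -> #|N| <= 2 * #|greedy s|.
Proof.
move=> mN sN; set M := greedy s.
have mM : is_matching M := greedy_matching s.
have sub : N \subset [set e in N | e.1 \in coverA M]
                 :|: [set e in N | e.2 \in coverB M].
  apply/subsetP => e eN; rewrite !inE eN /=; exact/greedy_maximal/sN.
apply: leq_trans (subset_leq_card sub) _; apply: leq_trans (leq_card_setU _ _) _.
rewrite mul2n -addnn; apply: leq_add.
  rewrite -(card_coverA mM) -(@card_in_imset _ _ (fun e => e.1)).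
    by apply/subset_leq_card/subsetP => x /imsetP[e]; rewrite inE => /andP[_ h] ->.
  by move=> e f; rewrite !inE => /andP[eN _] /andP[fN _]; apply: matching_inj1 mN _ _ eN fN.
rewrite -(card_coverB mM) -(@card_in_imset _ _ (fun e => e.2)).
  by apply/subset_leq_card/subsetP => x /imsetP[e]; rewrite inE => /andP[_ h] ->.
by move=> e f; rewrite !inE => /andP[eN _] /andP[fN _]; apply: matching_inj2 mN _ _ eN fN.
Qed.

End Greedy.

(** * How the sampled greedy matching depends on the sample *)

Section SampledGreedy.

Variables A B : finType.
Implicit Types (s : seq (A * B)) (S : {set A}).

Lemma tpM'_rcons s S e :
  tpM' (rcons s e) S =
  if [|| e.1 \notin S, e.1 \in coverA (tpM' s S) | e.2 \in coverB (tpM' s S)]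
  then tpM' s S else e |: tpM' s S.
Proof.
rewrite /tpM' /substream filter_rcons inE.
by case: (e.1 \in S) => //=; rewrite greedy_rcons.
Qed.

Lemma tpM'_matching s S : is_matching (tpM' s S).
Proof. exact: greedy_matching. Qed.

Lemma tpM'_sub s S e : e \in tpM' s S -> (e.1 \in S) && (e \in s).
Proof. by move=> /greedy_sub; rewrite mem_filter inE. Qed.

Lemma coverB_tpM'_mono s S S' :
  S \subset S' -> coverB (tpM' s S) \subset coverB (tpM' s S').
Proof.
move=> /subsetP sSS'.
(* Conversely, the vertices of [S] matched in the larger run are also matched
   in the smaller one; the two inclusions are preserved together. *)
suff [] : coverB (tpM' s S) \subset coverB (tpM' s S') /\
          coverA (tpM' s S') :&: S \subset coverA (tpM' s S) by [].
elim/last_ind: s => [|s e [/subsetP IB /subsetP IA]].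
  by rewrite /tpM' /= /coverA /coverB !imset0 set0I !sub0set.
have IA1 : e.1 \in S -> e.1 \in coverA (tpM' s S') -> e.1 \in coverA (tpM' s S).
  by move=> h1 h2; apply: IA; rewrite inE h1 h2.
have IB1 := IB e.2; have S1 := sSS' e.1.
rewrite !tpM'_rcons; split; apply/subsetP => x.
  move/(_ x): IB; case: ifP => [_|/negbT]; case: ifP => [h|_] //; rewrite ?coverBU1 ?inE.
  - by move=> H /H ->; rewrite orbT.
  (* Only the smaller run takes [e]: the A-end is sampled and, by the second inclusion, free in the
     larger run too, so that run refused [e] because its B-end was already matched. *)
  - rewrite !negb_or negbK => /and3P[eS nA nB] H /predU1P[->|/H //].
    case/or3P: h => //; first by rewrite (S1 eS).
    by move=> /(IA1 eS); rewrite (negPf nA).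
  - by move=> _ H /predU1P[->|/H ->]; rewrite ?eqxx ?orbT.
move/(_ x): IA; case: ifP => [_|/negbT]; case: ifP => [h|_] //; rewrite ?coverAU1 ?inE.
- by move=> H /H ->; rewrite orbT.
(* Only the larger run takes [e]: its B-end is free there, hence free in the smaller run by the
   first inclusion, which must have refused [e] for a matched A-end. *)
- rewrite !negb_or negbK => /and3P[eS nA nB] H /andP[/predU1P[->|xA] xS].
    case/or3P: h => [|//|]; first by rewrite xS.
    by move=> /IB1; rewrite (negPf nB).
  by apply: H; rewrite xA.
- by move=> _ H /andP[/predU1P[->|xA] xS]; rewrite ?eqxx ?H ?xA ?orbT.
Qed.

(** Any edge at an unmatched [a] that reached the run was refused for its B-end, so the run never
    depended on [a] being sampled. *)
Lemma tpM'_setD1 s S a :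
  a \notin coverA (tpM' s S) -> tpM' s (S :\ a) = tpM' s S.
Proof.
elim/last_ind: s => [|s e IH] //.
rewrite !tpM'_rcons; case: ifP => [h|/negbT].
  move=> /[dup] na /IH ->; case: ifP => // /negbT.
  rewrite !inE !negb_or negbK => /and3P[/andP[_ eS] nA nB].
  by move: h; rewrite eS (negPf nA) (negPf nB).
rewrite !negb_or negbK => /and3P[eS nA nB].
rewrite coverAU1 !inE negb_or => /andP[ne /IH ->].
by rewrite eS (negPf nA) (negPf nB) eq_sym ne.
Qed.

(** If [a] stayed unmatched, the run would be the same without it and leave [b] free as well,
    against maximality at the sampled edge [ab]. *)
Lemma tpM'_covers s S a b : (a, b) \in s -> a \in S ->
  b \notin coverB (tpM' s (S :\ a)) -> a \in coverA (tpM' s S).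
Proof.
move=> hs aS; apply: contraR => na; rewrite tpM'_setD1 //.
have /greedy_maximal : (a, b) \in substream (tpF1 B S) s by rewrite mem_filter inE aS.
by rewrite -/(tpM' s S) (negPf na).
Qed.

End SampledGreedy.

(** * Expectation over independent samples *)

Section Expectation.
Local Open Scope ring_scope.

Variables (R : realFieldType) (T : finType) (p : R).
Hypotheses (p_ge0 : 0 <= p) (p_le1 : p <= 1).
Implicit Types (X Y : {set T} -> R).

Local Notation Ex := (@expect_sample R T p).

Let weight (S : {set T}) : R := \prod_(x : T) (if x \in S then p else 1 - p).

Lemma eq_expect_sample X Y : X =1 Y -> Ex X = Ex Y.
Proof. by move=> h; apply: eq_bigr => S _; rewrite h. Qed.

Lemma expect_sample_le X Y : (forall S, X S <= Y S) -> Ex X <= Ex Y.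
Proof.
move=> h; apply: ler_sum => S _; apply: ler_wpM2l => //.
by apply: prodr_ge0 => x _; case: ifP => _ //; rewrite subr_ge0.
Qed.

Lemma expect_sampleD X Y : Ex (fun S => X S + Y S) = Ex X + Ex Y.
Proof. by rewrite -big_split; apply: eq_bigr => S _; rewrite mulrDr. Qed.

Lemma expect_sampleZ c X : Ex (fun S => c * X S) = c * Ex X.
Proof. by rewrite mulr_sumr; apply: eq_bigr => S _; rewrite mulrCA. Qed.

Lemma expect_sample_cst c : Ex (fun=> c) = c.
Proof.
rewrite /expect_sample -mulr_suml -[RHS]mul1r; congr (_ * _).
transitivity (\prod_(x : T) (p + (1 - p))); first by rewrite bigA_distr.
by rewrite big1 // => x _; rewrite addrC subrK.
Qed.

Lemma expect_sample_sum (I : finType) (P : pred I) (X : I -> {set T} -> R) :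
  Ex (fun S => \sum_(i | P i) X i S) = \sum_(i | P i) Ex (X i).
Proof.
by rewrite /expect_sample exchange_big; apply: eq_bigr => S _; rewrite mulr_sumr.
Qed.

(** Independence: [X (S :\ a)] ignores the coin of [a], which therefore factors out with probability
    [p]. *)
Lemma expect_sample_in a X :
  Ex (fun S => (a \in S)%:R * X (S :\ a)) = p * Ex (fun S => X (S :\ a)).
Proof.
pose w' (S : {set T}) : R := \prod_(x | x != a) (if x \in S then p else 1 - p).
have wE S : weight S = (if a \in S then p else 1 - p) * w' S.
  by rewrite /weight (bigD1 a).
have w'D S : w' (S :\ a) = w' S.
  by apply: eq_bigr => x ne; rewrite !inE ne.
pose Z := \sum_(S : {set T} | a \in S) w' S * X (S :\ a).
(* Toggling [a] pairs the samples avoiding [a] with those containing it; both [w'] and the value of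
   [X] are unchanged. *)
have EZ : \sum_(S : {set T} | a \notin S) w' S * X (S :\ a) = Z.
  rewrite (reindex_onto (fun S : {set T} => S :\ a) (fun S => a |: S)); last first.
    by move=> S /setU1K.
  apply: eq_big => [S|S _]; last by rewrite w'D setDDl setUid.
  rewrite !inE eqxx /=; apply/eqP/idP => [<-|aS]; first exact: setU11.
  exact: setD1K.
transitivity (p * Z).
  rewrite /expect_sample (bigID (fun S : {set T} => a \in S)) /= [X in _ + X]big1.
    rewrite addr0 mulr_sumr; apply: eq_bigr => S aS.
    by rewrite -/(weight S) wE aS mul1r mulrA.
  by move=> S /negPf ->; rewrite mul0r mulr0.
congr (_ * _); rewrite /expect_sample (bigID (fun S : {set T} => a \in S)) /=.
rewrite (eq_bigr (fun S => p * (w' S * X (S :\ a)))); last first.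
  by move=> S aS; rewrite -/(weight S) wE aS mulrA.
rewrite [X in _ = _ + X](eq_bigr (fun S => (1 - p) * (w' S * X (S :\ a)))).
  by rewrite -!mulr_sumr EZ -/Z; ring.
by move=> S /negPf aS; rewrite -/(weight S) wE aS mulrA.
Qed.

Lemma expect_sample_mem a : Ex (fun S => (a \in S)%:R) = p.
Proof.
transitivity (p * Ex (fun=> 1)); last by rewrite expect_sample_cst mulr1.
rewrite -(expect_sample_in a (fun=> 1)).
by apply: eq_bigr => S _; rewrite mulr1.
Qed.

End Expectation.

(** * The approximation ratio *)

Section SampleBound.
Local Open Scope ring_scope.

Variables (A B : finType) (R : realFieldType) (p : R).
Hypotheses (p_ge0 : 0 <= p) (p_le1 : p <= 1).
Variables (s : seq (A * B)).

Lemma card_sum_mem (T : finType) (D : {set T}) :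
  #|D|%:R = \sum_(x : T) (x \in D)%:R :> R.
Proof. by rewrite -sum1_card natr_sum big_mkcond; apply: eq_bigr => x _; case: ifP. Qed.

Lemma expect_sampled_greedy (N : {set A * B}) :
  is_matching N -> {subset N <= s} ->
  p * #|N|%:R <= (1 + p) * expect_sample p (fun S => #|tpM' s S|%:R).
Proof.
move=> mN sN.
pose PA a := expect_sample p (fun S => (a \in coverA (tpM' s S))%:R).
pose PB b := expect_sample p (fun S => (b \in coverB (tpM' s S))%:R).
have edge e : e \in N -> p <= PA e.1 + p * PB e.2.
  case: e => a b eN /=.
  have h1 : expect_sample p (fun S : {set A} =>
      (a \in S)%:R * (b \notin coverB (tpM' s (S :\ a)))%:R) <= PA a.
    apply: expect_sample_le => // S; rewrite -natrM mulnb ler_nat.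
    case: andP => // -[aS nb]; by rewrite (tpM'_covers (sN _ eN) aS nb).
  apply: le_trans (lerD h1 (lexx _)).
  (* By independence the coin of [a] contributes the factor [p]. It remains that the probabilities
     of [b] being free without [a] and of [b] being matched in the full run sum to at least 1, which
     is monotonicity in the sample. *)
  rewrite (expect_sample_in _ _ (fun S => (b \notin coverB (tpM' s S))%:R)).
  rewrite -mulrDr ler_peMr // -expect_sampleD -{1}(expect_sample_cst A p 1).
  apply: expect_sample_le => // S.
  have /subsetP /(_ b) := coverB_tpM'_mono s (subD1set S a).
  case: (b \in coverB (tpM' s (S :\ a))) => [/(_ isT) ->|_] /=.
    by rewrite add0r.
  by rewrite lerDl ler0n.
have cA : expect_sample p (fun S => #|tpM' s S|%:R) = \sum_a PA a.
  rewrite -expect_sample_sum; apply: eq_expect_sample => S.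
  by rewrite -(card_coverA (tpM'_matching _ _)) card_sum_mem.
have cB : expect_sample p (fun S => #|tpM' s S|%:R) = \sum_b PB b.
  rewrite -expect_sample_sum; apply: eq_expect_sample => S.
  by rewrite -(card_coverB (tpM'_matching _ _)) card_sum_mem.
have P0 (f : {set A} -> bool) : 0 <= expect_sample p (fun S => (f S)%:R).
  by rewrite -(expect_sample_cst A p 0); apply: expect_sample_le.
have : \sum_(e in N) p <= \sum_(e in N) (PA e.1 + p * PB e.2) by apply: ler_sum.
rewrite sumr_const -[p *+ _]mulr_natr => /le_trans; apply.
(* Distinct edges of [N] have distinct ends, so each sum runs over part of the vertices of one side
   and is at most the expected size of the sampled matching. *)
rewrite big_split mulrDl mul1r; apply: lerD.
  rewrite -(big_imset (fun a => PA a) (matching_inj1 mN)) cA.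
  rewrite [leRHS](bigID (mem (coverA N))) /= lerDl sumr_ge0 // => a _.
  exact: (P0 (fun S => a \in coverA (tpM' s S))).
rewrite -mulr_sumr ler_wpM2l //.
rewrite -(big_imset (fun b => PB b) (matching_inj2 mN)) cB.
rewrite [leRHS](bigID (mem (coverB N))) /= lerDl sumr_ge0 // => b _.
exact: (P0 (fun S => b \in coverB (tpM' s S))).
Qed.

End SampleBound.

(** * Structure and size of the augmented matching, sample by sample *)

Section TwoPass.

Variables (A B : finType) (s : seq (A * B)) (S : {set A}).

Local Notation M0 := (tpM0 s).
Local Notation M1 := (tpM1 s S).
Local Notation M2 := (tpM2 s S).

Lemma tpM0_matching : is_matching M0.
Proof. exact: greedy_matching. Qed.

Lemma tpM1_matching : is_matching M1.
Proof.
apply: matchingS (tpM'_matching s S); apply/subsetP => e.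
by rewrite inE => /andP[].
Qed.

Lemma tpM2_matching : is_matching M2.
Proof. exact: greedy_matching. Qed.

Lemma tpM1P a b : (a, b) \in M1 ->
  [/\ (a, b) \in tpM' s S, b \in coverB M0, a \notin coverA M0 & (a, b) \in s].
Proof. by rewrite inE /= => /and3P[h1 h2 h3]; case/andP: (tpM'_sub h1). Qed.

Lemma tpM2P a d : (a, d) \in M2 ->
  [/\ d \notin coverB M0, a \in coverA M0, (a, d) \in s &
      exists b c, (a, b) \in M0 /\ (c, b) \in M1].
Proof.
move=> /greedy_sub; rewrite mem_filter inE /= => /andP[/and3P[h1 h2 h3] h4].
split=> //; case/existsP: h3 => b /existsP[c /andP[]]; by exists b, c.
Qed.

(** At a given [a] the three sources do not compete: [M2]-edges start in A(M0), [M1]-edges outside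
    it, and an [M0]-edge is removed exactly when its A-end lies in A(M2). The machine outputs vertex
    by vertex along this case distinction. *)
Lemma mem_two_pass a b : ((a, b) \in two_pass s S) =
  if a \in coverA M2 then (a, b) \in M2
  else if a \in coverA M0 then (a, b) \in M0
  else ((a, b) \in M1) && [exists a', ((a', b) \in M0) && (a' \in coverA M2)].
Proof.
have E2 : [exists b', exists c, aug_path s S b a b' c] = ((a, b) \in M2).
  apply/existsP/idP => [[b' /existsP[c /and3P[]]] //|h].
  have [_ _ _ [b' [c [h1 h2]]]] := tpM2P h.
  by exists b'; apply/existsP; exists c; apply/and3P.
have E0 : (a, b) \in M0 ->
    [exists d, exists c, aug_path s S d a b c] = (a \in coverA M2).
  move=> h; apply/existsP/coverAP => -[d].
    by move=> /existsP[c /and3P[]]; exists d.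
  move=> h2; have [_ _ _ [b' [c [h3 h4]]]] := tpM2P h2.
  exists d; apply/existsP; exists c; apply/and3P; split=> //.
  by rewrite (matching_fun1 tpM0_matching h h3).
have E1 : [exists d, exists a', aug_path s S d a' b a] =
    ((a, b) \in M1) && [exists a', ((a', b) \in M0) && (a' \in coverA M2)].
  apply/existsP/andP => [[d /existsP[a' /and3P[h1 h2 h3]]]|].
    by split=> //; apply/existsP; exists a'; rewrite h2 (mem_coverA h1).
  move=> [h1 /existsP[a' /andP[h2 /coverAP[d h3]]]].
  by exists d; apply/existsP; exists a'; apply/and3P.
have -> : ((a, b) \in two_pass s S) =
    [|| ~~ [exists d, exists c, aug_path s S d a b c] && ((a, b) \in M0),
        (a, b) \in M2 |
        ((a, b) \in M1) && [exists a', ((a', b) \in M0) && (a' \in coverA M2)]].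
  by rewrite -E2 -E1 !inE /= -orbA.
have [aM2|aM2] := boolP (a \in coverA M2).
  have/coverAP[d /tpM2P[_ aM0 _ _]] := aM2.
  have -> : ((a, b) \in M1) = false.
    by apply/negP => /tpM1P[_ _]; rewrite aM0.
  have [/E0 ->|] := boolP ((a, b) \in M0); rewrite ?aM2 ?andbF ?orbF //.
have -> : ((a, b) \in M2) = false.
  by apply/negP => /mem_coverA; apply/negP.
rewrite orFb; have [aM0|aM0] := boolP (a \in coverA M0).
  have -> : ((a, b) \in M1) = false.
    by apply/negP => /tpM1P[_ _]; rewrite aM0.
  have [/E0 ->|] := boolP ((a, b) \in M0); by rewrite ?aM2 ?andbF ?orbF.
have -> : ((a, b) \in M0) = false.
  by apply/negP => /mem_coverA; apply/negP.
by rewrite andbF.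
Qed.

(** At an A-vertex, [mem_two_pass] selects a single one of three matchings. At a B-vertex,
    [M2]-edges end outside B(M0) and the others inside, while an [M1]-edge is used only where the
    [M0]-edge was removed. *)
Lemma two_pass_matching : is_matching (two_pass s S).
Proof.
have sel a b : (a, b) \in two_pass s S ->
    [\/ (a, b) \in M2 /\ b \notin coverB M0,
        (a, b) \in M0 /\ a \notin coverA M2 |
        (a, b) \in M1 /\ exists2 a', (a', b) \in M0 & a' \in coverA M2].
  rewrite mem_two_pass; case: ifP => [_ h|/negbT h2].
    by constructor 1; split=> //; case: (tpM2P h).
  case: ifP => [_ h|_ /andP[h /existsP[a' /andP[h3 h4]]]]; first by constructor 2.
  by constructor 3; split=> //; exists a'.
apply/is_matchingP => -[a b] [a' b'] he hf /= [E|E]; subst.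
  move: he hf; rewrite !mem_two_pass; case: ifP => _; last case: ifP => _.
  - by move=> h /(matching_fun1 tpM2_matching h) ->.
  - by move=> h /(matching_fun1 tpM0_matching h) ->.
  - by move=> /andP[h _] /andP[h' _]; rewrite (matching_fun1 tpM1_matching h h').
case: (sel _ _ he) (sel _ _ hf) => -[h1 h2] [] [h3 h4].
- by rewrite (matching_fun2 tpM2_matching h1 h3).
- by rewrite (mem_coverB h3) in h2.
- by case: h4 h2 => x /mem_coverB ->.
- by rewrite (mem_coverB h1) in h4.
- by rewrite (matching_fun2 tpM0_matching h1 h3).
- by case: h4 h2 => x /(matching_fun2 tpM0_matching h1) -> ->.
- by case: h2 h4 => x /mem_coverB ->.
- by case: h2 h4 => x /(matching_fun2 tpM0_matching h3) -> ->.
- by rewrite (matching_fun2 tpM1_matching h1 h3).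
Qed.

Lemma two_pass_sub e : e \in two_pass s S -> e \in s.
Proof.
case: e => a b; rewrite mem_two_pass; case: ifP => _; first by case/tpM2P.
by case: ifP => _; [apply: greedy_sub | case/andP=> /tpM1P[]].
Qed.

(** Counted on the B side: B(M0) and B(M2) are disjoint, and augmenting uncovers nothing, since a
    [b] that loses its [M0]-edge receives an [M1]-edge. *)
Lemma card_two_pass : #|M0| + #|M2| <= #|two_pass s S|.
Proof.
rewrite -(card_coverB tpM0_matching) -(card_coverB tpM2_matching).
rewrite -(card_coverB two_pass_matching) -cardsUI.
have -> : coverB M0 :&: coverB M2 = set0.
  apply/setP => b; rewrite !inE; apply/negP => /andP[h /coverBP[a /tpM2P[]]].
  by rewrite h.
rewrite cards0 addn0; apply: subset_leq_card; apply/subsetP => b.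
rewrite inE => /orP[] /coverBP[a h].
  have [aM2|aM2] := boolP (a \in coverA M2); last first.
    by apply: (@mem_coverB _ _ _ a); rewrite mem_two_pass (negPf aM2) (mem_coverA h).
  have /coverAP[d /tpM2P[_ _ _ [b' [c [h1 h2]]]]] := aM2.
  have E := matching_fun1 tpM0_matching h h1; subst b'.
  have [_ _ nc _] := tpM1P h2.
  apply: (@mem_coverB _ _ _ c); rewrite mem_two_pass h2 (negPf nc).
  case: ifP => [/coverAP[d' /tpM2P[_]]|_]; first by rewrite (negPf nc).
  by apply/existsP; exists a; rewrite h.
by apply: (@mem_coverB _ _ _ a); rewrite mem_two_pass h (mem_coverA h).
Qed.

(** The set [X] and the A-ends of [N1] both lie in A(M0), so inclusion-exclusion makes them share at
    least [#|X| + #|N1| - #|M0|] vertices. The edges of [N1] at these vertices form a matching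
    inside [F2], of which greedy finds at least half. *)
Lemma card_tpM2 (N : {set A * B}) : is_matching N -> {subset N <= s} ->
  #|M1| + #|N| <= 2 * #|M0| + 2 * #|M2|.
Proof.
move=> mN sN.
pose N1 := [set e in N | e.2 \notin coverB M0].
pose X := [set a in coverA M0 | [exists b, ((a, b) \in M0) && (b \in coverB M1)]].
have mN1 : is_matching N1 by apply: matchingS mN; apply/subsetP => e; rewrite inE; case/andP.
have cN : #|N| <= #|M0| + #|N1|.
  rewrite -(cardsID [set e in N | e.2 \in coverB M0] N); apply: leq_add.
    apply: leq_trans (subset_leq_card (subsetIr _ _)) _.
    rewrite -(card_coverB tpM0_matching) -(@card_in_imset _ _ (fun e => e.2)).
      by apply/subset_leq_card/subsetP => x /imsetP[e]; rewrite inE => /andP[_ h] ->.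
    by move=> e f; rewrite !inE => /andP[eN _] /andP[fN _]; apply: matching_inj2 mN _ _ eN fN.
  by apply/subset_leq_card/subsetP => e; rewrite /N1 !inE andbC; case: (e \in N).
have cX : #|M1| <= #|X|.
  rewrite -(card_coverB tpM1_matching).
  have sub : coverB M1 \subset coverB [set e in M0 | e.1 \in X].
    apply/subsetP => b hb; have /coverBP[c /tpM1P[_ /coverBP[a h] _ _]] := hb.
    apply: (@mem_coverB _ _ _ a); rewrite !inE /= h (mem_coverA h) /=.
    by apply/existsP; exists b; rewrite h.
  apply: leq_trans (subset_leq_card sub) _.
  have mX : is_matching [set e in M0 | e.1 \in X].
    by apply: matchingS tpM0_matching; apply/subsetP => e; rewrite inE => /andP[].
  rewrite (card_coverB mX) -(card_coverA mX).
  by apply/subset_leq_card/subsetP => a /coverAP[b]; rewrite inE => /andP[].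
have sAN : coverA N1 \subset coverA M0.
  apply/subsetP => a /coverAP[b]; rewrite inE => /andP[/sN h nb].
  by have := greedy_maximal h; rewrite -/M0 (negPf nb) orbF.
have sXA : X \subset coverA M0 by apply/subsetP => a; rewrite inE => /andP[].
pose N2 := [set e in N1 | e.1 \in X].
have mN2 : is_matching N2 by apply: matchingS mN1; apply/subsetP => e; rewrite inE => /andP[].
have cI : #|X :&: coverA N1| = #|N2|.
  rewrite -(card_coverA mN2); apply: eq_card => a; rewrite inE.
  apply/andP/coverAP => [[aX /coverAP[b h]]|[b]]; first by exists b; rewrite inE h.
  by rewrite inE => /andP[h h']; split=> //; apply: mem_coverA h.
have cU : #|X :|: coverA N1| <= #|M0|.
  by rewrite -(card_coverA tpM0_matching) subset_leq_card // subUset sXA sAN.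
have := cardsUI X (coverA N1); rewrite cI (card_coverA mN1).
have : #|N2| <= 2 * #|M2|.
  apply: card_le_greedy2 => // -[a d]; rewrite !inE mem_filter => /andP[/andP[h nd] /=].
  move=> /andP[ha /existsP[b /andP[h1 /coverBP[c h2]]]].
  rewrite (sN _ h) andbT inE nd ha /=.
  by apply/existsP; exists b; apply/existsP; exists c; rewrite h1.
lia.
Qed.

(** An edge of [M'] outside [M1] starts in A(M0) or misses B(M0), and by maximality of [M0] the
    latter forces the former. Such edges have distinct A-ends. *)
Lemma card_tpM1 : #|tpM' s S| <= #|M1| + #|S :&: coverA M0|.
Proof.
rewrite -(cardsID M1 (tpM' s S)); apply: leq_add.
  exact/subset_leq_card/subsetIr.
have mD : is_matching (tpM' s S :\: M1).
  exact: matchingS (subsetDl _ _) (tpM'_matching s S).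
rewrite -(card_coverA mD); apply/subset_leq_card/subsetP => a /coverAP[b].
rewrite !inE => /andP[+ h]; rewrite h /= negb_and negbK.
have /andP[/= -> hs] := tpM'_sub h.
case/orP => // nb; have := greedy_maximal hs.
by rewrite -/M0 /= (negPf nb) orbF.
Qed.

End TwoPass.

(** * Combining the bounds in expectation *)

Section Approximation.
Local Open Scope ring_scope.

Variables (A B : finType) (R : rcfType) (s : seq (A * B)).

Lemma two_pass_approx (N : {set A * B}) :
  is_matching N -> {subset N <= s} ->
  (1 / 2 + 19 / 1000) * #|N|%:R <=
    expect_sample (Num.sqrt 2 - 1 : R) (fun S => #|two_pass s S|%:R).
Proof.
move=> mN sN; set p := Num.sqrt 2 - 1.
have sq2 : (p + 1) * (p + 1) = 2.
  by rewrite /p subrK -expr2 sqr_sqrtr.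
have p0 : 0 <= p.
  by have := @ler_wsqrtr R 1 2 (ler1n _ 2); rewrite sqrtr1 subr_ge0.
have p_lo : 2 / 5 <= p by nra.
have p_hi : p <= 1 / 2 by nra.
have p1 : p <= 1 by lra.
have h0 := expect_sampled_greedy p0 p1 mN sN.
set m := #|N|%:R in h0 *.
set m0 : R := #|tpM0 s|%:R.
set E := expect_sample p _; set E' := expect_sample p _ in h0.
(* [M0] does not depend on the sample, so by linearity each of its A-vertices contributes [p]. *)
have ES : expect_sample p (fun S => #|S :&: coverA (tpM0 s)|%:R) = p * m0.
  rewrite /m0 -(card_coverA (tpM0_matching s)) mulr_natr -sumr_const.
  under [RHS]eq_bigr => a _ do rewrite -(expect_sample_mem p a).
  rewrite -expect_sample_sum.
  apply: eq_expect_sample => S.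
  rewrite card_sum_mem [RHS]big_mkcond; apply: eq_bigr => a _.
  by rewrite inE; case: (a \in S); case: (a \in coverA _).
have hM0 : m0 <= E.
  rewrite -(expect_sample_cst A p m0); apply: expect_sample_le => // S.
  by rewrite ler_nat (leq_trans _ (card_two_pass s S)) // leq_addr.
(* The three counting bounds hold for every sample; adding them before taking expectations
   eliminates [M1] and [M2]. *)
have hM : E' + m <= 2 * E + p * m0.
  rewrite -ES -(expect_sample_cst A p m) -expect_sampleZ -!expect_sampleD.
  apply: expect_sample_le => // S; rewrite -natrM -!natrD ler_nat.
  have := card_two_pass s S; have := card_tpM2 S mN sN; have := card_tpM1 s S.
  lia.
have m_ge0 : 0 <= m by rewrite ler0n.
(* With [m0 <= E] the bounds give [(1 + 2p) m <= (1 + p)(2 + p) E], and [(1 + p)(2 + p) = 3 + p] by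
   [sq2]. What is left is [519/1000 (3 + p) <= 1 + 2p], true since [p >= 2/5]. *)
nra.
Qed.

End Approximation.

(** * Executions of the machine *)

Fixpoint loop_free (c : cmd) : bool :=
  match c with
  | Seq c1 c2 | If _ c1 c2 => loop_free c1 && loop_free c2
  | While _ _ => false
  | _ => true
  end.

(** The value at [While] is a dummy, excluded by [loop_free]. *)
Fixpoint max_steps (c : cmd) : nat :=
  match c with
  | Seq c1 c2 => max_steps c1 + max_steps c2
  | If _ c1 c2 => (maxn (max_steps c1) (max_steps c2)).+1
  | _ => 1
  end.

(** Constant time per edge is a matter of syntax: the commands run on each edge contain no loop, so
    one number bounds all their executions. *)
Lemma exec_max_steps wd sp c s t s' :
  exec wd sp c s t s' -> loop_free c -> t <= max_steps c.
Proof.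
elim=> //=.
- move=> c1 c2 ? ? ? t1 t2 _ IH1 _ IH2 /andP[/IH1 h1 /IH2 h2]; exact: leq_add.
- move=> x c1 c2 ? ? t0 _ _ _ IH /andP[/IH h _].
  by rewrite ltnS (leq_trans h) // leq_maxl.
- move=> x c1 c2 ? ? t0 _ _ _ IH /andP[_ /IH h].
  by rewrite ltnS (leq_trans h) // leq_maxr.
Qed.

Lemma run_letters_inv wd sp T c (E : Type) (code : E -> nat * nat)
    (I : seq E -> state -> Prop) :
  (forall pre e s, I pre s ->
    can_feed wd sp (code e).1 (code e).2 /\
    exists t s1, [/\ exec wd sp c (feed (code e).1 (code e).2 s) t s1,
                     t <= T & I (rcons pre e) s1]) ->
  forall l pre s, I pre s ->
  exists2 s', run_letters wd sp T c [seq code e | e <- l] s s' & I (pre ++ l) s'.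
Proof.
move=> step; elim=> [|e l IH] pre s h.
  by exists s; [constructor | rewrite cats0].
have [cf [t [s1 [ex tT h1]]]] := step _ e _ h.
have [s2 r2 h2] := IH _ _ h1.
exists s2; last by rewrite -cat_rcons.
by rewrite /= (surjective_pairing (code e)); apply: LettersCons cf ex tT r2.
Qed.

(** * Vertex records in memory *)

Definition upd2 (d : nat -> nat -> nat) (v f y : nat) : nat -> nat -> nat :=
  fun v' f' => if (v' == v) && (f' == f) then y else d v' f'.

(* Cells below 14 are local variables, cells 14 and 15 are scratch space for
   address computations, and field [f < 4] of vertex [v] is cell
   [16 + 4 * v + f]. *)
Definition vaddr (v f : nat) : cmd :=
  Seq (Const 15 4) (Seq (Op Mul 14 v 15)
    (Seq (Const 15 (16 + f)) (Op Add 14 14 15))).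

Definition Get (x v f : nat) : cmd := Seq (vaddr v f) (Read x 14).
Definition Put (v f y : nat) : cmd := Seq (vaddr v f) (Write 14 y).

(** Cell 0 is the counter, cell 2 the bound and cell 7 the test; cell 5 is set to 1 after each
    round, so the body may overwrite it. *)
Definition For (body : cmd) : cmd :=
  Seq (Const 0 0) (Seq (Op Lt 7 0 2)
    (While 7 (Seq body (Seq (Const 5 1) (Seq (Op Add 0 0 5) (Op Lt 7 0 2)))))).

(** * Program logic over local cells and vertex records *)

Section Hoare.

Variables n wd sp : nat.

Implicit Types (m l : nat -> nat) (d : nat -> nat -> nat) (r : seq bool)
  (o : seq (nat * nat)).
Implicit Types Q : (nat -> nat) -> (nat -> nat -> nat) -> seq bool ->
  seq (nat * nat) -> Prop.

(** Cells 14 and 15 are left unconstrained, so that address computations do not show in the abstract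
    state. *)
Definition repr m l d : Prop :=
  (forall x, x < 14 -> m x = l x) /\
  (forall v f, v < n -> f < 4 -> m (16 + 4 * v + f) = d v f).

Definition holds Q (s : state) : Prop :=
  exists l d, repr (st_mem s) l d /\ Q l d (st_coins s) (st_out s).

(** A total-correctness weakest precondition. The step count is existential; [exec_max_steps] bounds
    it separately. *)
Definition hwp c l d r o Q : Prop :=
  forall m, repr m l d ->
  exists t s', exec wd sp c (State m r o) t s' /\ holds Q s'.

Lemma repr_local m l d x v : x < 14 -> repr m l d -> repr (upd m x v) (upd l x v) d.
Proof.
move=> hx [h1 h2]; split=> [y hy|w f hw hf]; rewrite /upd.
  by case: ifP => // _; apply: h1.
by rewrite -h2 //; case: eqP => //; lia.
Qed.

Lemma repr_scratch m l d x v : 14 <= x < 16 -> repr m l d -> repr (upd m x v) l d.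
Proof.
move=> hx [h1 h2]; split=> [y hy|w f hw hf]; rewrite /upd.
  by rewrite -h1 //; case: eqP => //; lia.
by rewrite -h2 //; case: eqP => //; lia.
Qed.

Lemma repr_field m l d v f y : f < 4 -> repr m l d ->
  repr (upd m (16 + 4 * v + f) y) l (upd2 d v f y).
Proof.
move=> hf [h1 h2]; split=> [x hx|v' f' hv' hf']; rewrite /upd /upd2.
  by rewrite -h1 //; case: eqP => //; lia.
rewrite -h2 //; have -> // : (16 + 4 * v' + f' == 16 + 4 * v + f) = (v' == v) && (f' == f).
by apply/eqP/andP => [E|[/eqP -> /eqP ->]] //; split; apply/eqP; lia.
Qed.

Hypothesis wd_ge : 32 * n.+1 <= 2 ^ wd.

Lemma small_fits v : v <= 31 + 32 * n -> v < 2 ^ wd.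
Proof. by move=> h; apply: leq_trans wd_ge; lia. Qed.

Hypothesis sp_ge : 16 + 4 * n <= sp.

Lemma exec_vaddr m l d r o v f : repr m l d -> v < 14 -> l v < n -> f < 4 ->
  exists m', [/\ exec wd sp (vaddr v f) (State m r o) 4 (State m' r o),
    repr m' l d & m' 14 = 16 + 4 * l v + f].
Proof.
move=> hr hv hn hf.
have mv : m v = l v by case: hr => ->.
pose m1 := upd m 15 4; pose m2 := upd m1 14 (l v * 4).
pose m3 := upd m2 15 (16 + f); exists (upd m3 14 (l v * 4 + (16 + f))).
split; last by rewrite /upd /=; lia.
  apply: (@ExecSeq _ _ _ _ _ (State m1 r o) _ 1 3).
    by apply: ExecConst; [lia | apply: small_fits; lia].
  have E2 : l v * 4 = eval_binop Mul (m1 v) (m1 15).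
    by rewrite /= /m1 /upd eqxx -mv; case: eqP => //; lia.
  apply: (@ExecSeq _ _ _ _ _ (State m2 r o) _ 1 2).
    by rewrite /m2 E2; apply: ExecOp; rewrite -?E2; try lia; apply: small_fits; lia.
  apply: (@ExecSeq _ _ _ _ _ (State m3 r o) _ 1 1).
    by apply: ExecConst; [lia | apply: small_fits; lia].
  have E4 : l v * 4 + (16 + f) = eval_binop Add (m3 14) (m3 15) by [].
  by rewrite E4; apply: ExecOp; rewrite -?E4; try lia; apply: small_fits; lia.
by do 4! apply: repr_scratch => //.
Qed.

Lemma hwp_mono c l d r o Q Q' : (forall l d r o, Q l d r o -> Q' l d r o) ->
  hwp c l d r o Q -> hwp c l d r o Q'.
Proof.
move=> sQ h m /h [t [s' [ex [l' [d' [hr hQ]]]]]].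
by exists t, s'; split=> //; exists l', d'; split=> //; apply: sQ.
Qed.

Lemma hwp_skip l d r o Q : Q l d r o -> hwp Skip l d r o Q.
Proof. by move=> h m hr; exists 1, (State m r o); split; [constructor | exists l, d]. Qed.

Lemma hwp_seq c1 c2 l d r o Q :
  hwp c1 l d r o (fun l d r o => hwp c2 l d r o Q) -> hwp (Seq c1 c2) l d r o Q.
Proof.
move=> h m /h [t [[m1 r1 o1] [ex [l1 [d1 [hr1 h1]]]]]].
have [t2 [s2 [ex2 hs]]] := h1 _ hr1.
by exists (t + t2), s2; split=> //; apply: ExecSeq ex ex2.
Qed.

Lemma hwp_const x k l d r o Q : x < 14 -> k <= 31 + 32 * n ->
  Q (upd l x k) d r o -> hwp (Const x k) l d r o Q.
Proof.
move=> hx hk hQ m hr; exists 1, (State (upd m x k) r o); split.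
  by apply: ExecConst; [lia | apply: small_fits].
by exists (upd l x k), d; split=> //; apply: repr_local.
Qed.

Lemma hwp_op b x y z l d r o Q : x < 14 -> y < 14 -> z < 14 ->
  eval_binop b (l y) (l z) <= 31 + 32 * n ->
  Q (upd l x (eval_binop b (l y) (l z))) d r o -> hwp (Op b x y z) l d r o Q.
Proof.
move=> hx hy hz hk hQ m hr; have [hl _] := hr.
exists 1, (State (upd m x (eval_binop b (l y) (l z))) r o); split.
  rewrite -!hl //; apply: ExecOp; try lia.
  by change (eval_binop b (m y) (m z) < 2 ^ wd); rewrite !hl //; apply: small_fits.
by exists (upd l x (eval_binop b (l y) (l z))), d; split=> //; apply: repr_local.
Qed.

Lemma hwp_get x v f l d r o Q : x < 14 -> v < 14 -> f < 4 -> l v < n ->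
  Q (upd l x (d (l v) f)) d r o -> hwp (Get x v f) l d r o Q.
Proof.
move=> hx hv hf hn hQ m hr.
have [m' [ex hr' E]] := exec_vaddr r o hr hv hn hf.
have D : m' (m' 14) = d (l v) f by rewrite E; case: hr' => _ ->.
exists (4 + 1), (State (upd m' x (d (l v) f)) r o); split.
  apply: ExecSeq ex _; rewrite -D; apply: ExecRead => /=; rewrite ?E; lia.
by exists (upd l x (d (l v) f)), d; split=> //; apply: repr_local.
Qed.

Lemma hwp_put v f y l d r o Q : v < 14 -> f < 4 -> y < 14 -> l v < n ->
  Q l (upd2 d (l v) f (l y)) r o -> hwp (Put v f y) l d r o Q.
Proof.
move=> hv hf hy hn hQ m hr.
have [m' [ex hr' E]] := exec_vaddr r o hr hv hn hf.
have D : m' y = l y by case: hr' => ->.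
exists (4 + 1), (State (upd m' (16 + 4 * l v + f) (l y)) r o); split.
  apply: ExecSeq ex _; rewrite -D -E; apply: ExecWrite => /=; rewrite ?E; lia.
by exists l, (upd2 d (l v) f (l y)); split=> //; apply: repr_field.
Qed.

Lemma hwp_flip x (b : bool) l d r o Q : x < 14 ->
  Q (upd l x b) d r o -> hwp (Flip x) l d (b :: r) o Q.
Proof.
move=> hx hQ m hr; exists 1, (State (upd m x b) r o); split.
  by apply: ExecFlip; [lia | apply: small_fits; case: b {hQ}].
by exists (upd l x b), d; split=> //; apply: repr_local.
Qed.

Lemma hwp_emit x y l d r o Q : x < 14 -> y < 14 ->
  Q l d r ((l x, l y) :: o) -> hwp (Emit x y) l d r o Q.
Proof.
move=> hx hy hQ m hr; have [hl _] := hr.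
exists 1, (State m r ((l x, l y) :: o)); split.
  by rewrite -!hl //; apply: ExecEmit; lia.
by exists l, d.
Qed.

Lemma hwp_if x c1 c2 l d r o Q : x < 14 ->
  (l x != 0 -> hwp c1 l d r o Q) -> (l x = 0 -> hwp c2 l d r o Q) ->
  hwp (If x c1 c2) l d r o Q.
Proof.
move=> hx h1 h2 m hr; have [hl _] := hr.
have [E|E] := eqVneq (l x) 0.
  have [t [s' [ex hs]]] := h2 E _ hr; exists t.+1, s'; split=> //.
  by apply: ExecIfF ex; rewrite /= ?hl //; lia.
have [t [s' [ex hs]]] := h1 E _ hr; exists t.+1, s'; split=> //.
by apply: ExecIfT ex; rewrite /= ?hl //; lia.
Qed.

Lemma hwp_while_true x c l d r o Q : x < 14 -> l x != 0 ->
  hwp c l d r o (fun l d r o => hwp (While x c) l d r o Q) ->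
  hwp (While x c) l d r o Q.
Proof.
move=> hx hl h m hr; have [t [[m1 r1 o1] [ex [l1 [d1 [hr1 h1]]]]]] := h _ hr.
have [t2 [s2 [ex2 hs]]] := h1 _ hr1.
exists (t + t2).+1, s2; split=> //; apply: ExecWhileT ex ex2; first lia.
by case: hr => /= ->.
Qed.

Lemma hwp_while_false x c l d r o Q : x < 14 -> l x = 0 ->
  Q l d r o -> hwp (While x c) l d r o Q.
Proof.
move=> hx hl hQ m hr; exists 1, (State m r o); split; last by exists l, d.
by apply: ExecWhileF; [lia | case: hr => /= ->].
Qed.

(** [J] sees records, coins and output but not the local cells, of which the body has to preserve
    only the counter and the bound. *)
Lemma hwp_for N body (J : nat -> (nat -> nat -> nat) -> seq bool ->
    seq (nat * nat) -> Prop) l d r o :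
  N <= n ->
  (forall k l d r o, k < N -> l 0 = k -> l 2 = N -> J k d r o ->
    hwp body l d r o (fun l d r o => [/\ l 0 = k, l 2 = N & J k.+1 d r o])) ->
  l 2 = N -> J 0 d r o ->
  hwp (For body) l d r o (fun l d r o => l 2 = N /\ J N d r o).
Proof.
move=> hN step l2 J0.
apply: hwp_seq; apply: hwp_const => //.
apply: hwp_seq; apply: hwp_op => //; rewrite /upd /= l2; first by case: (_ < _).
suff loop j : forall k l d r o, k + j = N ->
    l 0 = k -> l 2 = N -> l 7 = (k < N) -> J k d r o ->
    hwp (While 7 (Seq body (Seq (Const 5 1) (Seq (Op Add 0 0 5) (Op Lt 7 0 2)))))
        l d r o (fun l d r o => l 2 = N /\ J N d r o).
  by apply: (loop N 0).
elim: j {l d r o l2 J0} => [|j IH] k l d r o hk l0 l2 l7 hJ.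
  rewrite addn0 in hk; rewrite {}hk ?ltnn in l7 hJ.
  exact: hwp_while_false.
have kN : k < N by lia.
apply: hwp_while_true => //; first by rewrite l7 kN.
apply: hwp_seq; apply: hwp_mono (step k _ _ _ _ kN l0 l2 hJ).
move=> {l0 l2 l7 hJ} {}l {}d {}r {}o [l0 l2 hJ].
apply: hwp_seq; apply: hwp_const => //.
apply: hwp_seq; apply: hwp_op => //; rewrite /upd /= l0; first lia.
apply: hwp_op => //; rewrite /upd /= l2; first by case: (_ < _).
by apply: (IH k.+1); rewrite ?addn1 //; lia.
Qed.

Lemma hwp_exec c l d Q s : repr (st_mem s) l d ->
  hwp c l d (st_coins s) (st_out s) Q ->
  exists t s', exec wd sp c s t s' /\ holds Q s'.
Proof. by case: s => m r o /= hr /(_ _ hr). Qed.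

End Hoare.

(** * Matchings as mate tables *)

Section Mates.

Variables nA nB : nat.
Local Notation edge := ('I_nA * 'I_nB)%type.
Implicit Types (M : {set edge}) (a : 'I_nA) (b : 'I_nB) (d : nat -> nat -> nat).

(* The mate plus one; [0] encodes an unmatched vertex. *)
Definition mateA M a : nat :=
  if [pick b | (a, b) \in M] is Some b then b.+1 else 0.

Definition mateB M b : nat :=
  if [pick a | (a, b) \in M] is Some a then a.+1 else 0.

Variant mateA_spec M a : nat -> Prop :=
  | MateA b of (a, b) \in M : mateA_spec M a b.+1
  | NoMateA of a \notin coverA M : mateA_spec M a 0.

Variant mateB_spec M b : nat -> Prop :=
  | MateB a of (a, b) \in M : mateB_spec M b a.+1
  | NoMateB of b \notin coverB M : mateB_spec M b 0.

Lemma mateAP M a : mateA_spec M a (mateA M a).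
Proof.
rewrite /mateA; case: pickP => [b h|h]; constructor=> //.
by apply/coverAP => -[b]; rewrite h.
Qed.

Lemma mateBP M b : mateB_spec M b (mateB M b).
Proof.
rewrite /mateB; case: pickP => [a h|h]; constructor=> //.
by apply/coverBP => -[a]; rewrite h.
Qed.

Lemma mateA_eq M a b : is_matching M -> (a, b) \in M -> mateA M a = b.+1.
Proof.
move=> mM h; case: mateAP => [b' h'|]; last by rewrite (mem_coverA h).
by rewrite (matching_fun1 mM h h').
Qed.

Lemma mateB_eq M a b : is_matching M -> (a, b) \in M -> mateB M b = a.+1.
Proof.
move=> mM h; case: mateBP => [a' h'|]; last by rewrite (mem_coverB h).
by rewrite (matching_fun2 mM h h').
Qed.

Lemma mateA_none M a : a \notin coverA M -> mateA M a = 0.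
Proof. by move=> h; case: mateAP => // b /mem_coverA; rewrite (negPf h). Qed.

Lemma mateB_none M b : b \notin coverB M -> mateB M b = 0.
Proof. by move=> h; case: mateBP => // a /mem_coverB; rewrite (negPf h). Qed.

Definition try_insert M (e : edge) : {set edge} :=
  if (e.1 \in coverA M) || (e.2 \in coverB M) then M else e |: M.

Lemma mateAU1 M a b a' : is_matching M -> a \notin coverA M -> b \notin coverB M ->
  mateA ((a, b) |: M) a' = if a' == a then b.+1 else mateA M a'.
Proof.
move=> mM na nb.
have mU : is_matching ((a, b) |: M).
  by rewrite matchingU1 ?na ?nb //; apply: contra na; apply: mem_coverA.
case: eqP => [->|/eqP ne]; first by apply: mateA_eq; rewrite ?setU11.
case: (mateAP M a') => [b' h|h]; first by apply: mateA_eq; rewrite // setU1r.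
by apply: mateA_none; rewrite coverAU1 !inE negb_or ne.
Qed.

Lemma mateBU1 M a b b' : is_matching M -> a \notin coverA M -> b \notin coverB M ->
  mateB ((a, b) |: M) b' = if b' == b then a.+1 else mateB M b'.
Proof.
move=> mM na nb.
have mU : is_matching ((a, b) |: M).
  by rewrite matchingU1 ?na ?nb //; apply: contra na; apply: mem_coverA.
case: eqP => [->|/eqP ne]; first by apply: mateB_eq; rewrite ?setU11.
case: (mateBP M b') => [a' h|h]; first by apply: mateB_eq; rewrite // setU1r.
by apply: mateB_none; rewrite coverBU1 !inE negb_or ne.
Qed.

(* The vertices of the second class are numbered from [nA]. *)
Definition stores d (f : nat) M : Prop :=
  (forall a, d a f = mateA M a) /\ (forall b, d (nA + b) f = mateB M b).

Lemma stores_ext d d' f M :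
  (forall v, d' v f = d v f) -> stores d f M -> stores d' f M.
Proof. by move=> E [h1 h2]; split=> x; rewrite E. Qed.

End Mates.

(** * The program *)

(* The current edge is in cells 0 and 1, [nA] in cell 2, and the number of its
   second endpoint in cell 3. *)
Definition insert_edge (f : nat) : cmd :=
  Seq (Get 4 0 f) (If 4 Skip (Seq (Get 4 3 f) (If 4 Skip
    (Seq (Const 5 1) (Seq (Op Add 6 0 5) (Seq (Put 3 f 6)
      (Seq (Op Add 6 1 5) (Put 0 f 6)))))))).

(* Fields 0, 1, 2 hold the mates in [M0], [M'], [M2], field 3 the sample. *)
Definition init_sample : cmd :=
  Seq (Op Add 2 0 5) (For (Seq (Flip 4) (Put 0 3 4))).

Definition first_pass : cmd :=
  Seq (Op Add 3 2 1) (Seq (insert_edge 0)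
    (Seq (Get 4 0 3) (If 4 (insert_edge 1) Skip))).

(** [M1] is not stored: an [M']-edge at a B-vertex of [M0] belongs to it exactly when its A-end has
    no [M0]-mate, which is the last test. The subtractions undo the offset of mates. *)
Definition second_pass : cmd :=
  Seq (Op Add 3 2 1) (Seq (Const 5 1) (Seq (Get 4 3 0) (If 4 Skip
    (Seq (Get 4 0 0) (If 4
      (Seq (Op Defs.Sub 4 4 5) (Seq (Op Add 4 2 4) (Seq (Get 4 4 1) (If 4
        (Seq (Op Defs.Sub 4 4 5) (Seq (Get 4 4 0) (If 4 Skip (insert_edge 2))))
        Skip))))
      Skip))))).

(** The branches follow [mem_two_pass]; in the last one the [M']-edge is emitted only if its B-end
    has an [M0]-mate matched in [M2]. *)
Definition output_mate : cmd :=
  Seq (Const 5 1) (Seq (Get 4 0 2) (If 4 (Seq (Op Defs.Sub 4 4 5) (Emit 0 4))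
    (Seq (Get 4 0 0) (If 4 (Seq (Op Defs.Sub 4 4 5) (Emit 0 4))
      (Seq (Get 4 0 1) (If 4
        (Seq (Op Defs.Sub 4 4 5) (Seq (Op Add 6 2 4) (Seq (Get 6 6 0) (If 6
          (Seq (Op Defs.Sub 6 6 5) (Seq (Get 6 6 2) (If 6 (Emit 0 4) Skip)))
          Skip))))
        Skip)))))).

Definition two_pass_prog : stream_prog :=
  StreamProg [:: (init_sample, first_pass); (Skip, second_pass)]
    (For output_mate).

(** * Correctness of the program *)

Section Correctness.

Variables nA nB wd sp : nat.
Local Notation n := (nA + nB).
Hypotheses (sp_ge : 16 + 4 * n <= sp) (wd_ge : 32 * n.+1 <= 2 ^ wd).

Local Notation edge := ('I_nA * 'I_nB)%type.
Local Notation hwp := (hwp n wd sp).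
Local Notation holds := (holds n).
Implicit Types (l : nat -> nat) (d : nat -> nat -> nat) (r : seq bool)
  (o : seq (nat * nat)) (e : edge) (M : {set edge}).

Lemma ltn_A (a : 'I_nA) : a < n.
Proof. by apply: leq_trans (leq_addr _ _). Qed.

Lemma ltn_B (b : 'I_nB) : nA + b < n.
Proof. by rewrite ltn_add2l. Qed.

Lemma hwp_insert_edge f M e l d r o Q :
  f < 4 -> is_matching M -> stores d f M ->
  l 0 = e.1 -> l 1 = e.2 -> l 3 = nA + e.2 ->
  (forall l' d', (forall x, x < 4 -> l' x = l x) ->
    stores d' f (try_insert M e) ->
    (forall v f', f' != f -> d' v f' = d v f') -> Q l' d' r o) ->
  hwp (insert_edge f) l d r o Q.
Proof.
case: e => a b hf mM [sA sB] /= l0 l1 l3 hQ.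
have aN := ltn_A a; have bN := ltn_B b; have bB := ltn_ord b.
apply: hwp_seq; apply: hwp_get => //; rewrite /= l0 // sA.
apply: hwp_if => //; rewrite /upd /=.
  case: mateAP => [b' h _|//]; apply: hwp_skip; apply: hQ => //.
    by case=> [|[|[|[|]]]].
  by rewrite /try_insert (mem_coverA h).
case: mateAP => // na _.
apply: hwp_seq; apply: hwp_get => //; rewrite /upd /= l3 // sB.
apply: hwp_if => //; rewrite /upd /=.
  case: mateBP => [a' h _|//]; apply: hwp_skip; apply: hQ => //.
    by case=> [|[|[|[|]]]].
  by rewrite /try_insert (mem_coverB h) orbT.
case: mateBP => // nb _.
apply: hwp_seq; apply: hwp_const => //.
apply: hwp_seq; apply: hwp_op => //; rewrite /upd /= l0; first lia.
apply: hwp_seq; apply: hwp_put => //; rewrite /upd /= l3 //.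
apply: hwp_seq; apply: hwp_op => //; rewrite /upd /= l1; first lia.
apply: hwp_put => //; rewrite /upd /= l0 //; apply: hQ => [|| v f' /negPf hf'].
- by case=> [|[|[|[|]]]].
- rewrite /try_insert /= (negPf na) (negPf nb) /=.
  split=> [a'|b']; rewrite /upd2 eqxx !andbT.
    (* The numbering from [nA] keeps the records of the two sides apart. *)
    have -> : (a' == nA + b :> nat) = false.
      by apply/eqP; have := ltn_ord a'; lia.
    by rewrite mateAU1 // sA val_eqE addn1.
  have -> : (nA + b' == a) = false by apply/eqP; have := ltn_ord a; lia.
  by rewrite mateBU1 // sB eqn_add2l val_eqE addn1.
- by rewrite /upd2 hf' !andbF.
Qed.

Lemma run_pass T c (I : seq edge -> (nat -> nat) -> (nat -> nat -> nat) ->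
    seq bool -> seq (nat * nat) -> Prop) :
  loop_free c -> max_steps c <= T ->
  (forall pre e l d r o, I pre l d r o ->
    hwp c (upd (upd l 0 e.1) 1 e.2) d r o (I (rcons pre e))) ->
  forall s st, holds (I [::]) st ->
  exists2 st', run_letters wd sp T c [seq edge_code e | e <- s] st st' &
    holds (I s) st'.
Proof.
move=> lf cT step s st h0.
apply: (run_letters_inv (I := fun pre st => holds (I pre) st)) h0.
move=> pre e {}st [l [d [hr hI]]]; split.
  have := ltn_ord e.1; have := ltn_ord e.2; rewrite /can_feed /= => h1 h2.
  by rewrite !(small_fits wd_ge) ?andbT; lia.
have hr' : repr n (st_mem (feed e.1 e.2 st)) (upd (upd l 0 e.1) 1 e.2) d.
  by do 2! apply: repr_local => //.
have [t [s1 [ex h1]]] := hwp_exec hr' (step pre e _ _ _ _ hI).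
exists t, s1; split=> //; exact: leq_trans (exec_max_steps ex lf) cT.
Qed.

Variables (s : seq edge) (S : {set 'I_nA}).

Definition pass1_inv (pre : seq edge) l d r o : Prop :=
  [/\ l 2 = nA, stores d 0 (tpM0 pre), stores d 1 (tpM' pre S),
      stores d 2 (set0 : {set edge}) &
      (forall a : 'I_nA, d a 3 = (a \in S)) /\ o = [::]].

Lemma hwp_first_pass pre e l d r o : pass1_inv pre l d r o ->
  hwp first_pass (upd (upd l 0 e.1) 1 e.2) d r o (pass1_inv (rcons pre e)).
Proof.
case=> l2 s0 s1 s2 [s3 oE].
have aN := ltn_A e.1; have bN := ltn_B e.2.
apply: hwp_seq; apply: hwp_op => //; rewrite /upd /= l2; first lia.
apply: hwp_seq; apply: (hwp_insert_edge (e := e) _ (tpM0_matching pre) s0) => //.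
move=> l' d' El s0' Ed; rewrite /upd /= in El.
have l'0 := El 0 isT; have l'1 := El 1 isT; have l'2 := El 2 isT; have l'3 := El 3 isT.
rewrite /= in l'0 l'1 l'2 l'3; rewrite l2 in l'2.
have E0 : try_insert (tpM0 pre) e = tpM0 (rcons pre e).
  by rewrite /tpM0 greedy_rcons.
rewrite E0 in s0'.
have s1' : stores d' 1 (tpM' pre S) by apply: stores_ext s1 => v; apply: Ed.
apply: hwp_seq; apply: hwp_get => //; rewrite l'0 // Ed // s3.
apply: hwp_if => //; rewrite /upd /= => eS.
  apply: (hwp_insert_edge (e := e) _ (tpM'_matching pre S) s1') => //.
  move=> l'' d'' El' s1'' Ed'.
  split=> //; first by rewrite El'.
  - by apply: stores_ext s0' => v; apply: Ed'.
  - rewrite tpM'_rcons; move: eS s1''; rewrite /try_insert.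
    by case: (e.1 \in S).
  - by apply: stores_ext s2 => v; rewrite Ed' // Ed.
  - by split=> // a; rewrite Ed' // Ed.
apply: hwp_skip; split=> //.
- by rewrite tpM'_rcons; move: eS; case: (e.1 \in S).
- by apply: stores_ext s2 => v; rewrite Ed.
- by split=> // a; rewrite Ed.
Qed.

Definition pass2_inv (pre : seq edge) l d r o : Prop :=
  [/\ l 2 = nA, stores d 0 (tpM0 s), stores d 1 (tpM' s S),
      stores d 2 (greedy (substream (tpF2 s S) pre)) & o = [::]].

(** Mates in [M0] are unique, so the existential in [F2] is settled by the one mate [b] that the
    machine looks up. *)
Lemma mem_tpF2 a b c : (a, b) \in tpM0 s ->
  ((a, c) \in tpF2 s S) = (c \notin coverB (tpM0 s)) && (b \in coverB (tpM1 s S)).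
Proof.
move=> h; rewrite inE /= (mem_coverA h) /=; congr (_ && _).
apply/existsP/coverBP => [[b' /existsP[x /andP[h1 h2]]]|[x h1]].
  by exists x; rewrite (matching_fun1 (tpM0_matching s) h h1).
by exists b; apply/existsP; exists x; rewrite h.
Qed.

(** [b] is already in B(M0) and [c] is its only mate in [M'], so a single condition of [M1] remains
    open. *)
Lemma mem_coverB_tpM1 (a c : 'I_nA) b : (a, b) \in tpM0 s -> (c, b) \in tpM' s S ->
  (b \in coverB (tpM1 s S)) = (c \notin coverA (tpM0 s)).
Proof.
move=> h h'; apply/coverBP/idP => [[x /tpM1P[h1 _ nx _]]|nc].
  by rewrite (matching_fun2 (tpM'_matching s S) h' h1).
by exists c; rewrite inE /= h' (mem_coverB h).
Qed.

Lemma hwp_second_pass pre e l d r o : pass2_inv pre l d r o ->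
  hwp second_pass (upd (upd l 0 e.1) 1 e.2) d r o (pass2_inv (rcons pre e)).
Proof.
case: e => a c /= [l2 s0 s1 s2 oE].
have [s0A s0B] := s0; have [s1A s1B] := s1.
have aN := ltn_A a; have cN := ltn_B c.
have skip l' : (a, c) \notin tpF2 s S -> l' 2 = nA ->
    pass2_inv (rcons pre (a, c)) l' d r o.
  by move=> nF; split=> //; rewrite /substream filter_rcons (negPf nF).
apply: hwp_seq; apply: hwp_op => //; rewrite /upd /= l2; first lia.
apply: hwp_seq; apply: hwp_const => //.
apply: hwp_seq; apply: hwp_get => //; rewrite /upd /= // s0B.
apply: hwp_if => //=.
  case: mateBP => [x h _|//]; apply: hwp_skip; apply: skip => //.
  by rewrite inE /= (mem_coverB h).
case: mateBP => // nc _.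
apply: hwp_seq; apply: hwp_get => //; rewrite /upd /= // s0A.
apply: hwp_if => //=; last first.
  case: mateAP => // na _; apply: hwp_skip; apply: skip => //.
  by rewrite inE /= (negPf na) andbF.
case: mateAP => [b hab _|//].
have bN := ltn_B b; have F2E := mem_tpF2 c hab; rewrite nc /= in F2E.
apply: hwp_seq; apply: hwp_op => //; rewrite /upd /= subn1 /=; first lia.
apply: hwp_seq; apply: hwp_op => //; rewrite /upd /= l2; first lia.
apply: hwp_seq; apply: hwp_get => //; rewrite /upd /= // s1B.
apply: hwp_if => //=; last first.
  case: mateBP => // nb _; apply: hwp_skip; apply: skip => //.
  by rewrite F2E; apply: contra nb => /coverBP[x /tpM1P[/mem_coverB]].
case: mateBP => [x hxb _|//].
have xN := ltn_A x; rewrite (mem_coverB_tpM1 hab hxb) in F2E.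
apply: hwp_seq; apply: hwp_op => //; rewrite /upd /= subn1 /=; first lia.
apply: hwp_seq; apply: hwp_get => //; rewrite /upd /= // s0A.
apply: hwp_if => //=.
  case: mateAP => [y h _|//]; apply: hwp_skip; apply: skip => //.
  by rewrite F2E (mem_coverA h).
case: mateAP => // nx _; rewrite nx in F2E.
apply: (hwp_insert_edge (e := (a, c)) _ (greedy_matching _) s2) => //.
move=> l' d' El s2' Ed; split=> //; first by rewrite El.
- by apply: stores_ext s0 => v; apply: Ed.
- by apply: stores_ext s1 => v; apply: Ed.
- by rewrite /substream filter_rcons F2E greedy_rcons.
Qed.

Local Notation TP := (two_pass s S).

Definition output_of (a : 'I_nA) : seq (nat * nat) :=
  if mateA TP a is b.+1 then [:: (a : nat, b)] else [::].

Lemma hwp_output_mate (a : 'I_nA) l d r o Q :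
  stores d 0 (tpM0 s) -> stores d 1 (tpM' s S) -> stores d 2 (tpM2 s S) ->
  l 0 = a -> l 2 = nA ->
  (forall l', l' 0 = a -> l' 2 = nA -> Q l' d r (output_of a ++ o)) ->
  hwp output_mate l d r o Q.
Proof.
move=> [s0A s0B] [s1A s1B] [s2A s2B] l0 l2 hQ.
have aN := ltn_A a; have mTP := two_pass_matching s S.
apply: hwp_seq; apply: hwp_const => //.
apply: hwp_seq; apply: hwp_get => //; rewrite /upd /= l0 // s2A.
apply: hwp_if => //; rewrite /upd /=.
  case: mateAP => [b h _|//]; have bB := ltn_ord b.
  apply: hwp_seq; apply: hwp_op => //; rewrite /upd /= subn1 /=; first lia.
  apply: hwp_emit => //; rewrite /upd /= l0.
  have TPh : (a, b) \in TP by rewrite mem_two_pass (mem_coverA h).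
  by rewrite /output_of (mateA_eq mTP TPh) in hQ; apply: hQ.
case: mateAP => // n2 _.
apply: hwp_seq; apply: hwp_get => //; rewrite /upd /= l0 // s0A.
apply: hwp_if => //; rewrite /upd /=.
  case: mateAP => [b h _|//]; have bB := ltn_ord b.
  apply: hwp_seq; apply: hwp_op => //; rewrite /upd /= subn1 /=; first lia.
  apply: hwp_emit => //; rewrite /upd /= l0.
  have TPh : (a, b) \in TP by rewrite mem_two_pass (negPf n2) (mem_coverA h).
  by rewrite /output_of (mateA_eq mTP TPh) in hQ; apply: hQ.
case: mateAP => // n0 _.
have TPE b : ((a, b) \in TP) = ((a, b) \in tpM1 s S) &&
    [exists a', ((a', b) \in tpM0 s) && (a' \in coverA (tpM2 s S))].
  by rewrite mem_two_pass (negPf n2) (negPf n0).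
have none : (forall b, (a, b) \notin TP) -> output_of a = [::].
  by move=> h; rewrite /output_of mateA_none //; apply/coverAP => -[b]; apply/negP.
apply: hwp_seq; apply: hwp_get => //; rewrite /upd /= l0 // s1A.
apply: hwp_if => //; rewrite /upd /=; last first.
  case: mateAP => // n1 _; apply: hwp_skip.
  rewrite none in hQ; first exact: hQ.
  move=> b; rewrite TPE negb_and; apply/orP; left.
  by apply: contra n1 => /tpM1P[/mem_coverA].
case: mateAP => [b h _|//]; have bB := ltn_ord b; have bN := ltn_B b.
(* A returned edge at [a] can only be the [M']-edge there, so to show that there is none it is
   enough to exclude [b]. *)
have bE b' : (a, b') \in TP -> b' = b.
  rewrite TPE => /andP[/tpM1P[h' _ _ _] _].
  exact: matching_fun1 (tpM'_matching s S) h' h.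
apply: hwp_seq; apply: hwp_op => //; rewrite /upd /= subn1 /=; first lia.
apply: hwp_seq; apply: hwp_op => //; rewrite /upd /= l2; first lia.
apply: hwp_seq; apply: hwp_get => //; rewrite /upd /= // s0B.
apply: hwp_if => //; rewrite /upd /=; last first.
  case: mateBP => // nb _; apply: hwp_skip.
  rewrite none in hQ; first exact: hQ.
  move=> b'; apply/negP => /[dup] /bE ->; rewrite TPE => /andP[/tpM1P[_]].
  by rewrite (negPf nb).
case: mateBP => [x hx _|//]; have xN := ltn_A x.
apply: hwp_seq; apply: hwp_op => //; rewrite /upd /= subn1 /=; first lia.
apply: hwp_seq; apply: hwp_get => //; rewrite /upd /= // s2A.
apply: hwp_if => //; rewrite /upd /=.
  case: mateAP => [y hy _|//].
  apply: hwp_emit => //; rewrite /upd /= l0.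
  have TPh : (a, b) \in TP.
    rewrite TPE inE /= h (mem_coverB hx) n0 /=.
    by apply/existsP; exists x; rewrite hx (mem_coverA hy).
  by rewrite /output_of (mateA_eq mTP TPh) in hQ; apply: hQ.
case: mateAP => // nx _; apply: hwp_skip.
rewrite none in hQ; first exact: hQ.
move=> b'; apply/negP => /[dup] /bE ->.
rewrite TPE => /andP[_ /existsP[y /andP[/(matching_fun2 (tpM0_matching s) hx) <-]]].
by rewrite (negPf nx).
Qed.

Lemma stores_set0 d f : (forall v, d v f = 0) -> stores d f (set0 : {set edge}).
Proof.
move=> d0; split=> x; rewrite d0.
  by rewrite mateA_none // /coverA imset0 inE.
by rewrite mateB_none // /coverB imset0 inE.
Qed.

Lemma hwp_init_sample l d :
  l 0 = nA -> l 5 = 0 -> (forall v f, d v f = 0) ->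
  hwp init_sample l d [seq a \in S | a <- enum 'I_nA] [::] (pass1_inv [::]).
Proof.
set r := map _ _ => l0 l5 d0.
(* Cell 5 is still zero, so the addition copies [nA] into cell 2. *)
apply: hwp_seq; apply: hwp_op => //; rewrite /= l0 l5 addn0; first lia.
(* Coins are read in the order of [enum 'I_nA]: after [k] rounds the first [k] are consumed and the
   vertices below [k] carry their sample bit. *)
pose J k d' r' (o : seq (nat * nat)) := [/\ forall v f, f < 3 -> d' v f = 0,
  forall a : 'I_nA, a < k -> d' a 3 = (a \in S), r' = drop k r & o = [::]].
apply: hwp_mono (hwp_for wd_ge sp_ge (N := nA) (J := J) _ _ _ _) => //; last first.
- by split=> //; rewrite drop0.
- move=> k {l0 l5 d0}l {}d r' o kA l0 l2 [h0 h3 -> ->].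
  have sr : size r = nA by rewrite size_map size_enum_ord.
  rewrite (drop_nth false) ?sr // (nth_map (Ordinal kA)) ?size_enum_ord //.
  have -> : nth (Ordinal kA) (enum 'I_nA) k = Ordinal kA.
    by apply: val_inj; rewrite /= nth_enum_ord.
  apply: hwp_seq; apply: hwp_flip => //.
  apply: hwp_put => //; rewrite /upd /= l0; first lia.
  split=> //; split=> // [v f hf|a ak].
    by rewrite /upd2 h0 //; case: eqP => //=; case: eqP => //; lia.
  rewrite /upd2 eqxx andbT; case: eqP => [E|ne].
    by congr (nat_of_bool (_ \in S)); apply: val_inj.
  by apply: h3; lia.
- by rewrite leq_addr.
move=> {l0 l5}l {d0}d r' o [l2 [h0 h3 _ ->]].
split=> //; last by split=> // a; apply: h3.
- by apply: stores_set0 => v; apply: h0.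
- by apply: stores_set0 => v; apply: h0.
- by apply: stores_set0 => v; apply: h0.
Qed.

Lemma mem_output_of (a : 'I_nA) x : (x \in output_of a) =
  (x \in [seq edge_code e | e <- enum TP]) && (x.1 == a).
Proof.
have mTP := two_pass_matching s S; rewrite /output_of.
case: mateAP => [b h|na]; last first.
  apply/esym/negP => /andP[/mapP[[a' b'] /=]]; rewrite mem_enum => h -> /eqP /= E.
  by move: na; rewrite -(val_inj E) (mem_coverA h).
rewrite inE; apply/eqP/andP => [->|[/mapP[[a' b'] /=]]].
  by split=> //; apply/mapP; exists (a, b); rewrite ?mem_enum.
rewrite mem_enum => h' -> /eqP /= E; rewrite /edge_code /=.
by rewrite (val_inj E) in h' *; rewrite (matching_fun1 mTP h h').
Qed.

Lemma hwp_output l d r : pass2_inv s l d r [::] ->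
  hwp (For output_mate) l d r [::] (fun _ _ _ o =>
    perm_eq o [seq edge_code e | e <- enum TP]).
Proof.
case=> l2 s0 s1 s2 _; set out := map _ _.
(* The output after [k] rounds is tracked by membership; [uniq] is carried along because it turns
   equal membership into [perm_eq] at the end. *)
pose J k d' (r' : seq bool) (o : seq (nat * nat)) :=
  [/\ stores d' 0 (tpM0 s), stores d' 1 (tpM' s S), stores d' 2 (tpM2 s S), uniq o &
      forall x, (x \in o) = (x \in out) && (x.1 < k)].
apply: hwp_mono (hwp_for wd_ge sp_ge (N := nA) (J := J) _ _ _ _) => //; last first.
- by split=> // x; rewrite ltn0 andbF.
- move=> k {}l {s0 s1 s2}d {}r o kA l0 {}l2 [s0 s1 s2 uo mo].
  apply: (hwp_output_mate (a := Ordinal kA) s0 s1 s2) => // l' l'0 l'2.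
  split=> //; split=> // [|x].
    rewrite cat_uniq uo andbT; apply/andP; split.
      by rewrite /output_of; case: (mateA _ _).
    apply/hasPn => x; rewrite mo mem_output_of => /andP[_ xk].
    by rewrite negb_and (ltn_eqF xk) orbT.
  by rewrite mem_cat mem_output_of -/out mo -andb_orr -leq_eqVlt.
- by rewrite leq_addr.
move=> _ _ _ o [_ [_ _ _ uo mo]]; apply: uniq_perm => // [|x].
  rewrite map_inj_uniq ?enum_uniq // => -[a b] [a' b'] [Ea Eb].
  by rewrite (val_inj Ea) (val_inj Eb).
rewrite mo andb_idr // => /mapP[[a b] _ ->]; exact: ltn_ord.
Qed.

Lemma stream_run_two_pass T :
  max_steps first_pass <= T -> max_steps second_pass <= T ->
  exists2 o, stream_run wd sp T two_pass_prog s S o &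
    perm_eq o [seq edge_code e | e <- enum TP].
Proof.
move=> T1 T2.
have [t1 [st1 [ex1 h1]]] : exists t s', exec wd sp init_sample (init_state nB S) t s' /\
    holds (pass1_inv [::]) s'.
  apply: (hwp_exec (l := upd (upd (fun=> 0) 0 nA) 1 nB) (d := fun _ _ => 0)).
    by split=> // v f _ _; rewrite /= /upd; do 2! (case: eqP; first by lia).
  exact: hwp_init_sample.
have [st2 r2 [l2 [d2 [hr2 h2]]]] :=
  run_pass (c := first_pass) isT T1 hwp_first_pass s h1.
have [st3 r3 [l3 [d3 [hr3 h3]]]] : exists2 st3, run_letters wd sp T second_pass
    [seq edge_code e | e <- s] st2 st3 & holds (pass2_inv s) st3.
  apply: (run_pass (c := second_pass) isT T2 hwp_second_pass).
  by exists l2, d2; split=> //; case: h2 => ? ? ? ? [].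
have oE : st_out st3 = [::] by case: h3.
rewrite oE in h3.
have := hwp_exec hr3 (s := st3); rewrite oE.
move=> /(_ _ _ _ _ (hwp_output h3)) [t4 [st4 [ex4 [_ [_ [_ hp]]]]]].
exists (st_out st4) => //; exists st3, st4, t4; split=> //.
  by rewrite /can_feed !(small_fits wd_ge) ?andbT; lia.
apply: PassesCons ex1 r2 _; apply: PassesCons r3 _; last exact: PassesNil.
exact: ExecSkip.
Qed.

End Correctness.

(** * Space and time bounds *)

Lemma semi_streaming_two_pass : semi_streaming 2 (fun=> 1) two_pass_prog
  (fun nA nB (s : seq ('I_nA * 'I_nB)) S => two_pass s S).
Proof.
split=> //.
pose T := maxn (max_steps first_pass) (max_steps second_pass).
(* Six extra bits suffice: as [n < 2 ^ (trunc_log 2 n).+1], words of this length hold all values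
   below [32 * n.+1]. *)
exists (fun n => trunc_log 2 n + 6), (fun n => 16 + 4 * n), (fun=> T); split.
- exists 7, 2 => n hn; have : 0 < trunc_log 2 n by rewrite trunc_log_gt0.
  lia.
(* For [n >= 2] the logarithm is positive, so [16 + 4 * n <= 12 * n] and the word length is at most
   7 times the logarithm; 84 is the product. *)
- exists 1, 84, 2 => n hn; rewrite expn1.
  have : 0 < trunc_log 2 n by rewrite trunc_log_gt0.
  move: (trunc_log 2 n) => k; nia.
- by exists T, 0 => n _; rewrite muln1.
move=> nA nB s S _; apply: stream_run_two_pass; rewrite ?leq_maxl ?leq_maxr //.
have := trunc_log_ltn (nA + nB) (isT : 1 < 2).
by rewrite expnS expnD; move: (2 ^ trunc_log 2 _) => W; lia.
Qed.

Local Open Scope ring_scope.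

Theorem theorem3 (R : rcfType) :
  (exists P : stream_prog,
     semi_streaming 2 (fun=> 1%N) P
       (fun nA nB (s : seq ('I_nA * 'I_nB)) (A' : {set 'I_nA}) =>
          two_pass s A')) /\
  (forall (nA nB : nat) (E : {set 'I_nA * 'I_nB}) (s : seq ('I_nA * 'I_nB))
          (Mstar : {set 'I_nA * 'I_nB}),
     arrival_order s E -> maximum_matching E Mstar ->
     (forall A' : {set 'I_nA},
        is_matching (two_pass s A') /\ two_pass s A' \subset E) /\
     (1 / 2 + 19 / 1000) * #|Mstar|%:R
       <= expect_sample (Num.sqrt 2 - 1 : R)
            (fun A' : {set 'I_nA} => #|two_pass s A'|%:R)).
Proof.
split; first by exists two_pass_prog; apply: semi_streaming_two_pass.
move=> nA nB E s Mstar /perm_mem sE [mM /subsetP sM _].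
have {}sE e : (e \in s) = (e \in E) by rewrite sE mem_enum.
split=> [A'|].
  split; first exact: two_pass_matching.
  by apply/subsetP => e /two_pass_sub; rewrite sE.
by apply: two_pass_approx => // e /sM; rewrite sE.
Qed.
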